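(* An ideal $\mathcal{I}$ on $\mathbb{N}$ is $\mathcal{B}$-representable in a Banach space if, and only if, there is a nonpathological lower semicontinuous submeasure $\varphi$ on $\mathbb{N}$ such that $\mathcal{I}=\mathrm{FIN}(\varphi)$.
   Context: For a sequence $\mathbf{x}=(x_n)_{n\in\mathbb{N}}$ in a Banach space $X$ and $A\subseteq\mathbb{N}$, the series $\sum_{n\in A}x_n$ is perfectly bounded if there is $k>0$ such that $\|\sum_{n\in F}x_n\|\leq k$ for all finite $F\subseteq A$. Put $\mathcal{B}(\mathbf{x})=\{A\subseteq\mathbb{N}:\sum_{n\in A}x_n\text{ is perfectly bounded}\}$. $\mathcal{I}$ is $\mathcal{B}$-representable in a Banach space if $\mathcal{I}=\mathcal{B}(\mathbf{x})$ for some sequence $\mathbf{x}$ in some Banach space. A lower semicontinuous submeasure on $\mathbb{N}$ is a function $\varphi:\mathcal{P}(\mathbb{N})\to[0,\infty]$ with $\varphi(\emptyset)=0$, $\varphi(A)\leq\varphi(A\cup B)\leq\varphi(A)+\varphi(B)$, $\varphi(\{n\})<\infty$ for all $n$, and $\varphi(A)=\lim_{n\to\infty}\varphi(A\cap\{0,\dots,n\})$; it is nonpathological if $\varphi(A)=\sup\{\mu(A):\mu\text{ is a }\sigma\text{-additive measure on }\mathcal{P}(\mathbb{N})\text{ with }\mu\leq\varphi\}$ for all $A$. $\mathrm{FIN}(\varphi)=\{A\subseteq\mathbb{N}:\varphi(A)<\infty\}$. An ideal on $\mathbb{N}$ is a family of subsets closed under subsets and finite unions that contains $\emptyset$ but not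 $\mathbb{N}$. *)

(* Defs.v *)
From HB Require Import structures.
From mathcomp Require Import all_boot all_order all_algebra finmap.
From mathcomp Require Import all_classical all_reals all_analysis.

Set Implicit Arguments.
Unset Strict Implicit.
Unset Printing Implicit Defensive.

Import Order.TTheory GRing.Theory Num.Theory.
Import numFieldNormedType.Exports.

Local Open Scope classical_set_scope.
Local Open Scope ring_scope.

(* Families of subsets of the natural numbers are sets of type
   [set (set nat)]. An ideal need not contain the finite sets. *)
Definition is_ideal (I : set (set nat)) : Prop :=
  [/\ I set0,
      ~ I setT,
      (forall A B : set nat, A `<=` B -> I B -> I A) &
      (forall A B : set nat, I A -> I B -> I (A `|` B))].

Definition perfectly_bounded (R : realType) (X : completeNormedModType R)
    (x : nat -> X) (A : set nat) : Prop :=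
  exists2 k : R, 0 < k &
    forall F : {fset nat}, [set` F] `<=` A -> `|\sum_(n <- F) x n| <= k.

Definition Bset (R : realType) (X : completeNormedModType R)
    (x : nat -> X) : set (set nat) :=
  [set A | perfectly_bounded x A].

Definition B_representable (R : realType) (I : set (set nat)) : Prop :=
  exists (X : completeNormedModType R) (x : nat -> X), I = Bset x.

Local Open Scope ereal_scope.

Definition lsc_submeasure (R : realType) (phi : set nat -> \bar R) : Prop :=
  [/\ (forall A, 0 <= phi A),
      phi set0 = 0,
      (forall A B, phi A <= phi (A `|` B) /\ phi (A `|` B) <= phi A + phi B),
      (forall n, phi [set n] < +oo) &
      (forall A, phi (A `&` [set k | (k <= n)%N]) @[n --> \oo] --> phi A)].

(* The canonical measurable structure on [nat] is the discrete one, so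
   [{measure set nat -> \bar R}] is the type of [0, +oo]-valued sigma-additive
   measures on the whole power set. *)
Definition nonpathological (R : realType) (phi : set nat -> \bar R) : Prop :=
  forall A, phi A =
    ereal_sup [set mu A |
      mu in [set mu : {measure set nat -> \bar R} | forall B, mu B <= phi B]].

Definition FIN (R : realType) (phi : set nat -> \bar R) : set (set nat) :=
  [set A | phi A < +oo].

(* Main.v *)
Require Import Defs.
From HB Require Import structures.
From mathcomp Require Import all_boot all_order all_algebra finmap.
From mathcomp Require Import all_classical all_reals all_analysis.
From mathcomp Require Import lra.

(** Both directions compare, for finite sets [F] of indices, the norm of the
    partial sum of [x] over [F] with [phi F]. A lower semicontinuous submeasure
    is determined by its values on finite sets, so [Bset x = FIN phi] follows as
    soon as [phi F] dominates that norm and is at most twice the largest norm of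
    a sum over a subset of [F] ([FIN_Bset]).

    Given [x], every functional [f] of norm at most one produces the measure
    [A |-> \sum_(n in A) |f (x n)|], and [phi] is the supremum of these measures.
    A supremum of measures that is finite on singletons is always a
    nonpathological lower semicontinuous submeasure ([lsc_submeasure_sup],
    [nonpathological_sup]). That [phi F] dominates the norm is the Hahn-Banach
    theorem ([norming_functional]); the factor two comes from summing separately
    over the indices where [f (x n)] is nonnegative and where it is negative
    ([sum_abs_scalar_le]).

    Given a nonpathological [phi], let [X] be the Banach space of bounded
    functions on the set of measures, and let [x n] send a measure [mu <= phi] to
    [mu {n}]. The partial sum of [x] over [F] sends [mu] to [mu F], so its sup norm
    is the supremum of the values [mu F], which is [phi F] by
    nonpathologicality.

    The Hahn-Banach theorem is proved by taking a minimal sublinear functional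
    below the given one, which exists by Zorn's lemma and is automatically
    linear. *)

Set Implicit Arguments.
Unset Strict Implicit.
Unset Printing Implicit Defensive.

Import Order.TTheory GRing.Theory Num.Theory.
Import numFieldNormedType.Exports.

Local Open Scope classical_set_scope.
Local Open Scope ring_scope.

(** * Sublinear functionals and the Hahn-Banach theorem *)

Section HahnBanach.
Context {R : realType} {V : lmodType R}.
Implicit Types (p q : V -> R) (F : set (V -> R)).

Definition sublinear p : Prop :=
  (forall x y, p (x + y) <= p x + p y) /\
  (forall t x, 0 < t -> p (t *: x) = t * p x).

Lemma sublinear0 p : sublinear p -> p 0 = 0.
Proof.
by move=> [_ pZ]; have := pZ 2 0 ltac:(lra); rewrite scaler0 => ?; lra.
Qed.

Lemma sublinear_ge p x : sublinear p -> - p (- x) <= p x.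
Proof.
move=> sp; have := sp.1 x (- x); rewrite subrr sublinear0//; lra.
Qed.

Definition lower_envelope F (x : V) : R := inf [set a x | a in F].

Lemma lower_envelope_le F a x : has_lbound [set b x | b in F] -> F a ->
  lower_envelope F x <= a x.
Proof. by move=> Fb Fa; apply: ge_inf => //; exists a. Qed.

(** The two closure conditions are what survives of sublinearity when each
    inequality may be witnessed by a different member of the family. They hold
    for chains of sublinear functionals, where the smaller of two members is a
    witness, and for [descent_family], whose members are not sublinear. *)
Lemma sublinear_lower_envelope F : F !=set0 ->
  (forall x, has_lbound [set a x | a in F]) ->
  (forall a b x y, F a -> F b -> exists2 c, F c & c (x + y) <= a x + b y) ->
  (forall a t x, F a -> 0 < t -> exists2 c, F c & c (t *: x) <= t * a x) ->
  sublinear (lower_envelope F).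
Proof.
move=> F0 Flb FD FZ.
have ge_env z r : (forall a, F a -> r <= a z) -> r <= lower_envelope F z.
  move=> h; apply: lb_le_inf; first by case: F0 => a Fa; exists (a z), a.
  by move=> _ [a Fa <-]; exact: h.
have envZ t x : 0 < t -> lower_envelope F (t *: x) <= t * lower_envelope F x.
  move=> t0; rewrite -ler_pdivrMl//.
  apply: (ge_env) => a Fa.
  have [c Fc ca] := FZ a t x Fa t0.
  by rewrite ler_pdivrMl//; apply: le_trans ca; exact: lower_envelope_le.
split=> [x y|t x t0].
- rewrite -lerBlDr.
  apply: (ge_env) => a Fa.
  rewrite lerBlDr -lerBlDl; apply: (ge_env) => b Fb.
  have [c Fc cab] := FD a b x y Fa Fb.
  by rewrite lerBlDl; apply: le_trans cab; exact: lower_envelope_le.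
- apply/eqP; rewrite eq_le envZ//=.
  rewrite -ler_pdivlMl//; have := envZ t^-1 (t *: x).
  by rewrite scalerA mulVf ?gt_eqF// scale1r invr_gt0; exact.
Qed.

(** For sublinear [p], the infimum over [t >= 0] of
    [p (x + t *: y) - t * p y] is the standard device for lowering [p] so as to
    make it additive in the direction [y]. *)
Definition descent_family p (y : V) : set (V -> R) :=
  [set a | exists2 t : R, 0 <= t & a = fun x => p (x + t *: y) - t * p y].

Definition descent p y : V -> R := lower_envelope (descent_family p y).

(** Subadditivity applied to [t *: y = (x + t *: y) + (- x)] gives a lower bound
    that does not depend on [t]. *)
Lemma descent_bounded p y x : sublinear p ->
  has_lbound [set a x | a in descent_family p y].
Proof.
move=> sp; exists (- p (- x)) => _ [_ [t t0 ->] <-].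
have := sp.1 (- x) (x + t *: y); rewrite addKr.
have [->|tn0] := eqVneq t 0.
  by rewrite scale0r sublinear0// mul0r addr0; lra.
by rewrite (sp.2 t) ?lt0r ?tn0//; lra.
Qed.

Lemma descent_sublinear p y : sublinear p -> sublinear (descent p y).
Proof.
move=> sp; apply: sublinear_lower_envelope.
- by exists (fun x => p (x + 0 *: y) - 0 * p y), 0.
- by move=> x; exact: descent_bounded.
- move=> _ _ x z [t t0 ->] [s s0 ->].
  exists (fun x => p (x + (t + s) *: y) - (t + s) * p y).
    by exists (t + s) => //; exact: addr_ge0.
  have := sp.1 (x + t *: y) (z + s *: y).
  by rewrite addrACA -scalerDl; lra.
- move=> _ s x [t t0 ->] s0.
  exists (fun x => p (x + (s * t) *: y) - (s * t) * p y).
    by exists (s * t) => //; apply: mulr_ge0 => //; exact: ltW.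
  by rewrite -scalerA -scalerDr sp.2// mulrBr mulrA.
Qed.

Lemma descent_le p y t x : sublinear p -> 0 <= t ->
  descent p y x <= p (x + t *: y) - t * p y.
Proof.
move=> sp t0; rewrite /descent.
apply: (@lower_envelope_le _ (fun x => p (x + t *: y) - t * p y)).
  exact: descent_bounded.
by exists t.
Qed.

Lemma descent_le_self p y x : sublinear p -> descent p y x <= p x.
Proof.
move=> sp; have := descent_le y x sp (lexx 0).
by rewrite scale0r addr0 mul0r subr0.
Qed.

Definition minimal_sublinear q : Prop :=
  sublinear q /\ forall r, sublinear r -> (forall x, r x <= q x) -> r = q.

(** Zorn's lemma applies because the pointwise infimum of a chain of sublinear
    functionals below [p] is again one; the infimum is finite since a sublinear
    [a <= p] satisfies [a x >= - a (- x) >= - p (- x)]. *)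
Lemma exists_minimal_sublinear p : sublinear p ->
  exists2 q, minimal_sublinear q & forall x, q x <= p x.
Proof.
move=> sp.
pose T := {q : V -> R | sublinear q /\ forall x, q x <= p x}.
pose below (s t : T) := `[< forall x, sval t x <= sval s x >].
have T_eq (s t : T) : sval s = sval t -> s = t.
  by case: s t => [s sP] [t tP] /= st; subst t; congr exist;
    exact: Prop_irrelevance.
have [|||A Atot|q qmin] := @Zorn T below.
- by move=> t; apply/asboolP.
- move=> r s t /asboolP rs /asboolP st; apply/asboolP => x.
  exact: le_trans (st x) (rs x).
- move=> s t /asboolP st /asboolP ts; apply: T_eq; apply/funext => x.
  by apply/eqP; rewrite eq_le st ts.
- have [->|/set0P[a0 Aa0]] := eqVneq A set0.
    by exists (exist _ p (conj sp (fun x => lexx (p x)))) => s.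
  pose F := [set sval a | a in A].
  have Flb x : has_lbound [set a x | a in F].
    exists (- p (- x)) => _ [_ [[a [sa ap]] /= _ <-] <-].
    by apply: le_trans (sublinear_ge x sa); rewrite lerN2; exact: ap.
  have env_le a x : A a -> lower_envelope F x <= sval a x.
    by move=> Aa; apply: lower_envelope_le => //; exists a.
  have senv : sublinear (lower_envelope F).
    apply: sublinear_lower_envelope => //.
    + by exists (sval a0), a0.
    + move=> _ _ x y [a Aa <-] [b Ab <-].
      (* the smaller of two comparable functionals serves for both *)
      have [/asboolP ab|/asboolP ba] := Atot a b Aa Ab.
      * exists (sval b); first by exists b.
        by apply: le_trans ((svalP b).1.1 x y) _; rewrite lerD2r; exact: ab.
      * exists (sval a); first by exists a.
        by apply: le_trans ((svalP a).1.1 x y) _; rewrite lerD2l; exact: ba.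
    + move=> _ t x [a Aa <-] t0; exists (sval a); first by exists a.
      by rewrite (svalP a).1.2.
  have envp x : lower_envelope F x <= p x.
    exact: le_trans (env_le a0 x Aa0) ((svalP a0).2 x).
  exists (exist _ (lower_envelope F) (conj senv envp)) => s As.
  by apply/asboolP => x /=; exact: env_le.
- case: q qmin => q [sq qp] qmin; exists q => //; split=> // r sr rq.
  have rp x : r x <= p x by exact: le_trans (rq x) (qp x).
  by have /(congr1 sval) := qmin (exist _ r (conj sr rp)) ltac:(by apply/asboolP).
Qed.

(** Minimality forces [descent q y = q] for every [y], and comparing with the
    value at [t = 1] gives [q x <= q (x + y) - q y], the reverse of
    subadditivity. *)
Lemma minimal_sublinear_scalar q : minimal_sublinear q -> scalar q.
Proof.
move=> [sq qmin].
have qD x y : q (x + y) = q x + q y.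
  apply/eqP; rewrite eq_le sq.1/=.
  rewrite -{1}(qmin _ (descent_sublinear y sq)); last first.
    by move=> z; exact: descent_le_self.
  have := descent_le y x sq (@ler01 R); rewrite scale1r mul1r; lra.
have qN x : q (- x) = - q x.
  by apply/eqP; rewrite -addr_eq0 -qD addNr sublinear0.
move=> t x y; rewrite qD; congr (_ + _) => /=.
have [t0|t0|->] := ltgtP t 0; last by rewrite scale0r sublinear0// mul0r.
- by rewrite -[t]opprK scaleNr qN sq.2 ?oppr_gt0// !mulNr.
- exact: sq.2.
Qed.

(** A minimal sublinear functional [f] is sought below [descent p v] rather than
    only below [p], because this gives
    [f (- v) <= p (- v + v) - p v = - p v], hence [f v >= p v]. *)
Lemma hahn_banach p v : sublinear p ->
  exists f : {scalar V}, (forall x, f x <= p x) /\ f v = p v.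
Proof.
move=> sp.
have [q minq qp'] := exists_minimal_sublinear (descent_sublinear v sp).
have qp x : q x <= p x by apply: le_trans (qp' x) (descent_le_self _ _ sp).
pose qL := GRing.isLinear.Build _ _ _ _ q (minimal_sublinear_scalar minq).
pose f : {scalar V} := HB.pack q qL.
exists f; split=> //.
apply/eqP; rewrite eq_le qp/=.
have := le_trans (qp' (- v)) (descent_le v (- v) sp ler01).
rewrite scale1r mul1r addNr sublinear0// sub0r.
by rewrite -[q (- v)]/(f (- v)) linearN lerN2.
Qed.

End HahnBanach.

Lemma norming_functional (R : realType) (X : normedModType R) (v : X) :
  exists f : {scalar X}, (forall x, `|f x| <= `|x|) /\ f v = `|v|.
Proof.
have sn : sublinear (fun x : X => `|x|).
  split=> [x y|t x t0]; first exact: ler_normD.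
  by rewrite normrZ gtr0_norm.
have [f [fle fv]] := hahn_banach v sn.
exists f; split=> // x; rewrite ler_norml fle andbT.
by have := fle (- x); rewrite linearN normrN; lra.
Qed.

(** * The Banach space of bounded functions *)

Section BoundedFunctions.
Context {R : realType} {T : Type}.

Definition bounded_funs : {pred T -> R} :=
  fun f => `[< exists M : R, forall t, `|f t| <= M >].

Lemma bounded_funsP (f : T -> R) :
  reflect (exists M : R, forall t, `|f t| <= M) (f \in bounded_funs).
Proof. exact: asboolP. Qed.

Lemma bounded_funs_submod_closed : submod_closed bounded_funs.
Proof.
split; first by apply/bounded_funsP; exists 0 => t; rewrite normr0.
move=> c f g /bounded_funsP[M fM] /bounded_funsP[N gN].
apply/bounded_funsP; exists (`|c| * M + N) => t.
apply: le_trans (ler_normD _ _) _.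
by rewrite lerD// normrM ler_wpM2l.
Qed.

HB.instance Definition _ :=
  GRing.isSubmodClosed.Build R (T -> R) bounded_funs bounded_funs_submod_closed.

Record bfun := BFun { bfun_val :> T -> R; _ : bfun_val \in bounded_funs }.

HB.instance Definition _ := [isSub for bfun_val].
HB.instance Definition _ := [Choice of bfun by <:].
HB.instance Definition _ := [SubChoice_isSubLmodule of bfun by <:].

Implicit Types f g : bfun.

(** The value [0] is added to the set so that its supremum is also meaningful
    when [T] is empty. *)
Definition supnorm f : R := sup [set r | r = 0 \/ exists t, r = `|f t|].

Lemma supnorm_le f (M : R) : 0 <= M -> (forall t, `|f t| <= M) ->
  supnorm f <= M.
Proof.
move=> M0 fM; apply: ge_sup; first by exists 0; left.
by move=> _ [->//|[t ->]].
Qed.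

Let supnorm_ub f : has_ubound [set r | r = 0 \/ exists t, r = `|f t|].
Proof.
have /bounded_funsP[M fM] := valP f.
exists (Num.max 0 M) => _ [->|[t ->]]; first by rewrite le_max lexx.
by rewrite le_max fM orbT.
Qed.

Lemma supnorm_ge f t : `|f t| <= supnorm f.
Proof. by apply: ub_le_sup => //; right; exists t. Qed.

Lemma supnorm_ge0 f : 0 <= supnorm f.
Proof. by apply: ub_le_sup => //; left. Qed.

Lemma bfunD f g t : (f + g) t = f t + g t.
Proof. by []. Qed.

Lemma supnormD f g : supnorm (f + g) <= supnorm f + supnorm g.
Proof.
apply: supnorm_le; first by rewrite addr_ge0// supnorm_ge0.
by move=> t; rewrite bfunD (le_trans (ler_normD _ _))// lerD// supnorm_ge.
Qed.

Lemma supnormZ_le (c : R) f : supnorm (c *: f) <= `|c| * supnorm f.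
Proof.
apply: supnorm_le; first by rewrite mulr_ge0// supnorm_ge0.
by move=> t; rewrite [X in `|X|](_ : _ = c * f t)// normrM ler_wpM2l// supnorm_ge.
Qed.

Lemma supnorm_eq0 f : supnorm f = 0 -> f = 0.
Proof.
move=> f0; apply/val_inj/funext => t /=; apply/eqP.
by rewrite -normr_le0 -f0 supnorm_ge.
Qed.

Lemma supnormZ (c : R) f : supnorm (c *: f) = `|c| * supnorm f.
Proof.
apply/eqP; rewrite eq_le supnormZ_le/=.
have [->|c0] := eqVneq c 0; first by rewrite normr0 mul0r supnorm_ge0.
rewrite -ler_pdivlMl ?normr_gt0// -normfV.
by apply: le_trans (supnormZ_le _ _); rewrite scalerA mulVf// scale1r.
Qed.

HB.instance Definition _ :=
  Lmodule_isNormed.Build R bfun supnormD supnormZ supnorm_eq0.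

Lemma bfun_norm_ge f t : `|f t| <= `|f|.
Proof. exact: supnorm_ge. Qed.

Lemma bfun_norm_le f (M : R) : 0 <= M -> (forall t, `|f t| <= M) -> `|f| <= M.
Proof. exact: supnorm_le. Qed.

Lemma bfun_sum (I : Type) (s : seq I) (F : I -> bfun) t :
  (\sum_(i <- s) F i) t = \sum_(i <- s) F i t.
Proof. by elim/big_ind2 : _ => // _ u _ v <- <-. Qed.

(** Evaluation at a point maps a Cauchy filter to a Cauchy filter of reals. The
    pointwise limits form a bounded function, and convergence is uniform because
    the Cauchy estimate does not depend on the point. *)
Lemma bfun_complete (F : set_system bfun) : ProperFilter F -> cauchy F -> cvg F.
Proof.
move=> FF /cauchy_ballP Fc.
have FcE (e : R) : 0 < e -> exists2 A, F A & forall f g, A f -> A g -> `|f - g| < e.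
  move=> e0; have := Fc e e0; rewrite near_map2.
  case=> -[A B] /= [FA FB] AB; exists (A `&` B); first exact: filterI.
  by move=> f g [Af _] [_ Bg]; have := AB (f, g) (conj Af Bg); rewrite -ball_normE.
have Fcvg t : cvg ((fun f : bfun => f t) @ F).
  apply: cauchy_cvg; apply/cauchy_ballP => e e0.
  have [A FA AP] := FcE e e0.
  rewrite near_map2; exists (A, A) => //= -[f g] /= [Af Ag].
  rewrite -ball_normE /=; apply: le_lt_trans (AP _ _ Af Ag).
  exact: (bfun_norm_ge (f - g)).
pose l t : R := lim ((fun f : bfun => f t) @ F).
(* a Cauchy estimate on a set of the filter passes to the pointwise limit *)
have l_near (e : R) A : (forall f g, A f -> A g -> `|f - g| < e) -> F A ->
    forall f, A f -> forall t, `|f t - l t| <= e.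
  move=> AP FA f Af t; rewrite distrC.
  have lt : (fun g : bfun => g t - f t) @ F --> l t - f t.
    by apply: cvgB; [exact: Fcvg|exact: cvg_cst].
  have ln : (fun g : bfun => `|g t - f t|) @ F --> `|l t - f t|.
    by exact: cvg_norm lt.
  rewrite -(cvg_lim (@Rhausdorff R) ln); apply: limr_le.
    by apply/cvg_ex; exists `|l t - f t|.
  apply: filterS FA => g Ag /=.
  exact: le_trans (bfun_norm_ge (g - f) t) (ltW (AP _ _ Ag Af)).
have lb : l \in bounded_funs.
  have [A FA AP] := FcE 1 ltr01.
  have [f Af] := filter_ex FA.
  apply/bounded_funsP; exists (`|f| + 1) => t.
  rewrite -[l t](subrK (f t)) addrC; apply: le_trans (ler_normD _ _) _.
  by rewrite lerD ?bfun_norm_ge// distrC; exact: l_near AP FA _ Af t.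
apply/cvg_ex; exists (BFun lb); apply/cvgrPdist_le => e e0.
have [A FA AP] := FcE e e0.
near=> f; rewrite distrC; apply: bfun_norm_le; first exact: ltW.
by move=> t; apply: (l_near e A AP FA f); near: f.
Unshelve. all: by end_near. Qed.

HB.instance Definition _ := Uniform_isComplete.Build bfun bfun_complete.

End BoundedFunctions.
Arguments bfun : clear implicits.


(** * Suprema of measures and lower semicontinuous submeasures *)

Section Submeasures.
Context {R : realType}.
Local Open Scope ereal_scope.
Implicit Types (phi : set nat -> \bar R) (A B : set nat).
Implicit Types (mu : {measure set nat -> \bar R}).
Implicit Types (S : set {measure set nat -> \bar R}).

Lemma lsc_submeasure_mono phi A B : lsc_submeasure phi -> A `<=` B ->
  phi A <= phi B.
Proof. by move=> [_ _ phiU _ _] /setUidr <-; exact: (phiU A B).1. Qed.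

(** Lower semicontinuity makes [phi A] the limit of its values on the finite
    initial segments of [A]. *)
Lemma lsc_submeasure_fset phi A (M : \bar R) : lsc_submeasure phi ->
  (forall F : {fset nat}, [set` F] `<=` A -> phi [set` F] <= M) ->
  phi A <= M.
Proof.
move=> [_ _ _ _ /(_ A) phicvg] phiM.
rewrite -(cvg_lim (@ereal_hausdorff R) phicvg).
apply: lime_le; first by apply/cvg_ex; exists (phi A).
apply: nearW => n.
have finAn : finite_set (A `&` [set k | (k <= n)%N]).
  by apply: finite_setIr; exact: (finite_II n.+1).
rewrite -[A `&` _](fset_setK finAn); apply: phiM.
by rewrite fset_setK// => k [].
Qed.

Lemma measure_fset (mu : {measure set nat -> \bar R}) (F : {fset nat}) :
  mu [set` F] = \sum_(n <- F) mu [set n].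
Proof.
rewrite -measure_fbigsetU//; last by move=> i j _ _ [k [/= -> ->]].
by rewrite -bigcup_fset bigcup_imset1 image_id.
Qed.

Definition sup_measure (S : set {measure set nat -> \bar R}) A : \bar R :=
  ereal_sup [set mu A | mu in S].

Lemma sup_measure_ge S mu A : S mu -> mu A <= sup_measure S A.
Proof. by move=> Smu; apply: ereal_sup_ubound; exists mu. Qed.

Lemma sup_measure_le S A (M : \bar R) : (forall mu, S mu -> mu A <= M) ->
  sup_measure S A <= M.
Proof. by move=> SM; apply: ge_ereal_sup => _ [mu Smu <-]; exact: SM. Qed.

Lemma sup_measure_mono S A B : A `<=` B -> sup_measure S A <= sup_measure S B.
Proof.
move=> AB; apply: sup_measure_le => mu Smu.
by apply: le_trans (sup_measure_ge B Smu); apply: le_measure; rewrite ?inE.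
Qed.

(** Each measure is continuous from below, and a supremum of functions with that
    property inherits it because the two suprema, over measures and over initial
    segments, commute. *)
Lemma lsc_submeasure_sup (S : set {measure set nat -> \bar R}) :
  S !=set0 -> (forall n, sup_measure S [set n] < +oo) ->
  lsc_submeasure (sup_measure S).
Proof.
move=> [mu0 Smu0] Sfin; split=> //.
- by move=> A; apply: le_trans (sup_measure_ge A Smu0).
- apply/eqP; rewrite eq_le; apply/andP; split.
    by apply: sup_measure_le => mu _; rewrite measure0.
  by apply: le_trans (sup_measure_ge _ Smu0).
- move=> A B; split; first by apply: sup_measure_mono; exact: subsetUl.
  apply: sup_measure_le => mu Smu.
  by apply: le_trans (measureU2 _ _ _) _ => //; apply: leeD; exact: sup_measure_ge.
- move=> A; pose An n := A `&` [set k | (k <= n)%N].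
  have An_mono : {homo An : n m / (n <= m)%N >-> (n <= m)%O}.
    move=> n m nm; apply/subsetPset => k [Ak kn]; split=> //=.
    exact: leq_trans kn nm.
  have AnA : \bigcup_n An n = A.
    by apply/seteqP; split=> [k [n _ []]//|k Ak]; exists k => //; split=> /=.
  rewrite [X in _ --> X](_ : _ = ereal_sup (range (sup_measure S \o An))).
    apply: (@ereal_nondecreasing_cvgn _ (sup_measure S \o An)) => n m nm.
    by apply: sup_measure_mono; apply/subsetPset; exact: An_mono.
  apply/eqP; rewrite eq_le; apply/andP; split; last first.
    by apply: ge_ereal_sup => _ [n _ <-]; apply: sup_measure_mono => k [].
  apply: sup_measure_le => mu Smu.
  have mucvg : mu (An n) @[n --> \oo] --> mu A.
    rewrite -[X in _ --> mu X]AnA; exact: nondecreasing_cvg_mu.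
  rewrite -(cvg_lim (@ereal_hausdorff R) mucvg).
  apply: lime_le; first by apply/cvg_ex; exists (mu A).
  apply: nearW => n; apply: le_trans (sup_measure_ge _ Smu) _.
  by apply: ereal_sup_ubound; exists n.
Qed.

(** The measures in [S] are among the measures dominated by [sup_measure S]. *)
Lemma nonpathological_sup (S : set {measure set nat -> \bar R}) :
  nonpathological (sup_measure S).
Proof.
move=> A; apply/eqP; rewrite eq_le; apply/andP; split.
- apply: ereal_sup_le => _ [mu Smu <-]; exists mu => // B.
  exact: sup_measure_ge.
- by apply: ge_ereal_sup => _ [mu mule <-]; exact: mule.
Qed.

(** Bounds on finite sets suffice: finiteness of [phi A] amounts to a uniform
    bound on [phi F] for finite [F `<=` A], and perfect boundedness is a uniform
    bound on the norms of the corresponding partial sums. *)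
Lemma FIN_Bset (X : completeNormedModType R) (x : nat -> X) phi :
  lsc_submeasure phi ->
  (forall F : {fset nat}, `|(\sum_(n <- F) x n)%R|%:E <= phi [set` F]) ->
  (forall (F : {fset nat}) (k : R),
    (forall G : {fset nat}, [set` G] `<=` [set` F] ->
      (`|\sum_(n <- G) x n| <= k)%R) -> phi [set` F] <= (2 * k)%:E) ->
  Bset x = FIN phi.
Proof.
move=> sphi xphi phix; apply/seteqP; split=> A /=.
- move=> [k k0 kA]; apply: (@le_lt_trans _ _ (2 * k)%:E); last exact: ltry.
  apply: lsc_submeasure_fset => // F FA; apply: phix => G GF.
  by apply: kA; exact: subset_trans FA.
- move=> phiA.
  have phiA0 : 0 <= phi A by case: sphi => + _ _ _ _; exact.
  have phiAE : (fine (phi A))%:E = phi A by rewrite fineK// ge0_fin_numE.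
  (* adding 1 makes the bound strictly positive even when phi A is 0 *)
  exists (fine (phi A) + 1)%R; first by rewrite ltr_wpDl// fine_ge0.
  move=> F FA; rewrite -lee_fin EFinD phiAE.
  apply: (le_trans (xphi F)); apply: (le_trans (lsc_submeasure_mono sphi FA)).
  by rewrite leeDl// lee01.
Qed.

End Submeasures.

(** * The variation of a weight on the natural numbers *)

Section Variation.
Context {R : realType} (w : nat -> R).
Local Open Scope ereal_scope.

Definition variation (A : set nat) : \bar R := \esum_(n in A) `|w n|%:E.

Let variation0 : variation set0 = 0. Proof. exact: esum_set0. Qed.

Let variation_ge0 A : 0 <= variation A. Proof. exact: esum_ge0. Qed.

Let variation_semi_sigma_additive : semi_sigma_additive variation.
Proof.
move=> F _ tF _; rewrite /variation esum_bigcupT//.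
rewrite [X in _ --> X](_ : _ = \sum_(0 <= n <oo | xpredT n) variation (F n)).
  by apply: is_cvg_nneseries => *; exact: variation_ge0.
by rewrite nneseries_esum//; congr esum; apply/seteqP.
Qed.

HB.instance Definition _ := isMeasure.Build _ _ _ variation
  variation0 variation_ge0 variation_semi_sigma_additive.

Lemma variation_fset (F : {fset nat}) :
  variation [set` F] = (\sum_(n <- F) `|w n|)%:E.
Proof.
rewrite measure_fset -sumEFin; apply: eq_bigr => n _.
by rewrite [LHS]esum_set1.
Qed.

End Variation.

(** * Representing ideals *)

Section Representation.
Context {R : realType}.
Local Open Scope ereal_scope.

Definition contractive (X : normedModType R) (f : {scalar X}) : Prop :=
  forall v, (`|f v| <= `|v|)%R.

(** Splitting [F] according to the sign of [f (x n)], each half contributes the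
    absolute value of [f] at one partial sum. *)
Lemma sum_abs_scalar_le (X : normedModType R) (f : {scalar X}) (x : nat -> X)
    (F : {fset nat}) (k : R) : contractive f ->
  (forall G : {fset nat}, [set` G] `<=` [set` F] ->
    (`|\sum_(n <- G) x n| <= k)%R) ->
  (\sum_(n <- F) `|f (x n)| <= 2 * k)%R.
Proof.
move=> fc kF.
have sub (Q : pred nat) : [set` [fset n in F | Q n]%fset] `<=` [set` F].
  by move=> n /=; rewrite !inE => /andP[].
have fk (G : {fset nat}) : [set` G] `<=` [set` F] ->
    (`|\sum_(n <- G) f (x n)| <= k)%R.
  move=> GF; rewrite -linear_sum.
  by apply: le_trans (fc _) _; exact: kF.
rewrite (bigID (fun n => 0 <= f (x n))%R)/= mulr_natl mulr2n; apply: lerD.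
- rewrite (eq_bigr (fun n => f (x n))); last by move=> n; exact: ger0_norm.
  rewrite big_fset_condE.
  by apply: le_trans (ler_norm _) _; exact: fk.
- rewrite (eq_bigr (fun n => - f (x n))%R); last first.
    by move=> n; rewrite -ltNge => /ltr0_norm.
  rewrite sumrN big_fset_condE.
  by apply: le_trans (ler_norm _) _; rewrite normrN; exact: fk.
Qed.

(** On singletons the supremum of the variations is at most [`|x n|], so it is
    finite there. The family is nonempty, as it contains the variation given by
    a functional norming the zero vector. *)
Lemma Bset_FIN (X : completeNormedModType R) (x : nat -> X) :
  exists phi : set nat -> \bar R,
    lsc_submeasure phi /\ nonpathological phi /\ Bset x = FIN phi.
Proof.
pose S : set {measure set nat -> \bar R} :=
  [set mu | exists2 f : {scalar X}, contractive f &
    mu = variation (fun n => f (x n))].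
have S_le (F : {fset nat}) (M : R) :
    (forall f : {scalar X}, contractive f ->
      (\sum_(n <- F) `|f (x n)| <= M)%R) ->
    sup_measure S [set` F] <= M%:E.
  move=> FM; apply: sup_measure_le => _ [f fc ->].
  by rewrite variation_fset lee_fin; exact: FM.
have Slsc : lsc_submeasure (sup_measure S).
  apply: lsc_submeasure_sup.
    have [f [fc _]] := norming_functional (0 : X)%R.
    by exists (variation (fun n => f (x n))), f.
  move=> n; rewrite -set_fset1; apply: (@le_lt_trans _ _ `|x n|%:E).
    by apply: S_le => f fc; rewrite big_seq_fset1; exact: fc.
  exact: ltry.
exists (sup_measure S); split=> //; split; first exact: nonpathological_sup.
apply: FIN_Bset => // F.
- have [f [fc fF]] := norming_functional (\sum_(n <- F) x n)%R.
  have Sf : S (variation (fun n => f (x n))) by exists f.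
  apply: le_trans (sup_measure_ge _ Sf).
  rewrite [leRHS]variation_fset lee_fin -fF linear_sum.
  by apply: le_trans (ler_norm _) _; exact: ler_norm_sum.
- by move=> k kF; apply: S_le => f fc; exact: sum_abs_scalar_le.
Qed.

(** The index set is the type of all measures; the coordinates of [x n] at the
    measures that are not dominated by [phi] are set to [0], which leaves every
    norm unaffected. *)
Lemma FIN_B_representable (phi : set nat -> \bar R) :
  lsc_submeasure phi -> nonpathological phi -> B_representable R (FIN phi).
Proof.
move=> sphi nphi; have [phi_ge0 phi0 _ phi1 _] := sphi.
pose T := {measure set nat -> \bar R}.
pose adm (mu : T) : Prop := forall B, mu B <= phi B.
pose e n (mu : T) : R := if `[< adm mu >] then fine (mu [set n]) else 0%R.
have fin1 mu n : adm mu -> mu [set n] \is a fin_num.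
  by move=> muphi; rewrite ge0_fin_numE//; exact: le_lt_trans (phi1 n).
have eb n : e n \in bounded_funs.
  apply/bounded_funsP; exists (fine (phi [set n])) => mu; rewrite /e.
  case: asboolP => [muphi|_]; last by rewrite normr0 fine_ge0.
  rewrite ger0_norm ?fine_ge0// fine_le ?fin1//.
  by rewrite ge0_fin_numE.
pose x n : bfun R T := BFun (eb n).
have xE (F : {fset nat}) mu : adm mu -> ((\sum_(n <- F) x n)%R mu)%:E = mu [set` F].
  move=> muphi; rewrite bfun_sum measure_fset -sumEFin.
  apply: eq_bigr => n _; rewrite /= /e; case: asboolP => // _.
  by rewrite fineK// fin1.
have xE0 (F : {fset nat}) mu : ~ adm mu -> (\sum_(n <- F) x n)%R mu = 0%R.
  move=> nmu; rewrite bfun_sum big1// => n _.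
  by rewrite /= /e; case: asboolP.
exists (bfun R T : completeNormedModType R), x; apply/esym.
apply: FIN_Bset => // F.
- have [phiF|phiF] := ltP (phi [set` F]) +oo; last first.
    by apply: le_trans phiF; rewrite leey.
  have phiFE : (fine (phi [set` F]))%:E = phi [set` F].
    by rewrite fineK// ge0_fin_numE.
  rewrite -phiFE lee_fin; apply: bfun_norm_le; first exact: fine_ge0.
  move=> mu; have [muphi|nmu] := pselect (adm mu); last first.
    by rewrite xE0// normr0 fine_ge0.
  rewrite -lee_fin phiFE -abse_EFin xE// gee0_abs//; exact: muphi.
- move=> k kF.
  have k0 : (0 <= k)%R by exact: le_trans (kF F _).
  rewrite nphi; apply: ge_ereal_sup => _ [mu muphi <-].
  rewrite -xE// lee_fin; apply: le_trans (ler_norm _) _.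
  apply: le_trans (bfun_norm_ge _ mu) _.
  by apply: le_trans (kF F _) _ => //; lra.
Qed.

End Representation.

Theorem theorem5p10 (R : realType) (I : set (set nat)) (hI : is_ideal I) :
  B_representable R I <->
  exists phi : set nat -> \bar R,
    lsc_submeasure phi /\ nonpathological phi /\ I = FIN phi.
Proof.
split=> [[X [x ->]]|[phi [sphi [nphi ->]]]]; first exact: Bset_FIN.
exact: FIN_B_representable.
Qed.
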